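(* For each $l\in\mathbb{Z}$ let $q^{(l)}$ be a positive real number and $\phi_l\in L^2(\mathbb{R},dx)$, and let $\{T_{nq^{(l)}}\phi_l\}_{n,l\in\mathbb{Z}}$ be a nonstationary frame of translates for $L^2(\mathbb{R},dx)$ with frame operator $\mathcal S$. If $\{T_{nq^{(l)}}\phi_l\}_{n,l\in\mathbb{Z}}$ is linearly independent and, for all $f\in L^2(\mathbb{R},dx)$ and all $n,l\in\mathbb{Z}$, $$\big\langle f,\mathcal S_{s,t}^{-1}T_{nq^{(l)}}\phi_l\big\rangle\to\big\langle f,\mathcal S^{-1}T_{nq^{(l)}}\phi_l\big\rangle\quad\text{as }s,t\to\infty,$$ then $\{T_{nq^{(l)}}\phi_l\}_{n,l\in\mathbb{Z}}$ is a Riesz basis of $L^2(\mathbb{R},dx)$.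
   Context: $\mathbb{N}$ is the set of positive integers and $T_af(x)=f(x-a)$ is translation by $a\in\mathbb{R}$. A countable family $\{\varphi_k\}_k$ in a separable Hilbert space $\mathcal H$ is a frame for $\mathcal H$ if there are $\alpha,\beta\in(0,\infty)$ with $\alpha\|f\|^2\le\sum_k|\langle f,\varphi_k\rangle|^2\le\beta\|f\|^2$ for all $f\in\mathcal H$; its frame operator is $\mathcal Sf=\sum_k\langle f,\varphi_k\rangle\varphi_k$, bounded and invertible on $\mathcal H$. A nonstationary frame of translates is a frame for $L^2(\mathbb{R},dx)$ of the form $\{T_{nq^{(l)}}\phi_l\}_{n,l\in\mathbb{Z}}$. A Riesz basis for $\mathcal H$ is a family $\{\Xi\chi_k\}_k$ with $\{\chi_k\}_k$ an orthonormal basis of $\mathcal H$ and $\Xi$ a bounded linear bijective operator on $\mathcal H$. For $s,t\in\mathbb{N}$ let $\mathbb{F}_1=\{-s,\dots,s\}$, $\mathbb{F}_2=\{-t,\dots,t\}$ and $\mathcal V=\operatorname{span}\{T_{nq^{(l)}}\phi_l\}_{n\in\mathbb{F}_1,\,l\in\mathbb{F}_2}$ (depending on $s,t$). The finite family $\{T_{nq^{(l)}}\phi_l\}_{n\in\mathbb{F}_1,\,l\in\mathbb{F}_2}$ is a frame for $\mathcal V$, and $\mathcal S_{s,t}:\mathcal V\to\mathcal V$, $\mathcal S_{s,t}f=\sum_{n\in\mathbb{F}_1}\sum_{l\in\mathbb{F}_2}\langle f,T_{nq^{(l)}}\phi_l\rangle T_{nq^{(l)}}\phi_l$, is its (invertible)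 frame operator. The vector $\mathcal S_{s,t}^{-1}T_{nq^{(l)}}\phi_l$ is considered for $s\ge|n|$, $t\ge|l|$, where it makes sense. *)

(* Defs.v *)
From HB Require Import structures.
From mathcomp Require Import all_boot all_order all_algebra.
From mathcomp Require Import finmap ring_quotient sesquilinear complex.
From mathcomp Require Import all_classical all_reals all_analysis.
From mathcomp Require Import measurable_realfun.
From mathcomp Require summability.

Set Implicit Arguments.
Unset Strict Implicit.
Unset Printing Implicit Defensive.

Import Order.TTheory GRing.Theory Num.Theory.
Import numFieldNormedType.Exports.

Local Open Scope classical_set_scope.
Local Open Scope ring_scope.

Local Notation Re := (@complex.Re _).
Local Notation Im := (@complex.Im _).

(* Complex inner product spaces; the inner product is linear in its first and
   conjugate linear in its second argument. *)
HB.mixin Record NormedModule_isPreHilbert (R : realType) H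
    & NormedModule R[i] H := {
  inner : {dot H for @Num.conj R[i]} ;
  inner_norm : forall x : H, `|x| ^+ 2 = inner x x
}.

#[short(type="preHilbertType")]
HB.structure Definition PreHilbert (R : realType) :=
  {H of NormedModule R[i] H & NormedModule_isPreHilbert R H}.

Notation "''[' u , v ]" := (inner u v) (format "''[' u ,  v ]") : ring_scope.

(* `|x| lives in R[i]; this is its square as an element of R. *)
Definition sqnorm (R : realType) (V : normedZmodType R[i]) (x : V) : R :=
  Re (`|x| ^+ 2).

Section Frames.
Context (R : realType) (H : preHilbertType R).

Definition lspan (A : set H) : set H :=
  [set x | exists n (c : 'I_n -> R[i]) (v : 'I_n -> H),
     (forall i, A (v i)) /\ x = \sum_(i < n) c i *: v i].

Section Families.
Context (I : countType) (phi : I -> H).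

Definition is_frame : Prop :=
  exists alpha beta : R, [/\ 0 < alpha, 0 < beta & forall f : H,
    ((alpha * sqnorm f)%:E <= \esum_(k in [set: I]) (sqnorm '[f, phi k])%:E
       <= (beta * sqnorm f)%:E)%E].

(* summability.sum is the limit, in norm, of the net of finite partial sums. *)
Definition frame_op (f : H) : H :=
  summability.sum (fun k => '[f, phi k] *: phi k).

Definition lin_indep : Prop :=
  forall (J : {fset I}) (c : I -> R[i]),
    \sum_(k <- J) c k *: phi k = 0 -> forall k, k \in J -> c k = 0.

Definition orthonormal_basis : Prop :=
  (forall k j, '[phi k, phi j] = (k == j)%:R) /\
  closure (lspan (range phi)) = [set: H].

End Families.

Definition riesz_basis (I : countType) (phi : I -> H) : Prop :=
  exists (chi : I -> H) (Xi : {linear H -> H}),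
    [/\ orthonormal_basis chi,
        exists M : R, forall f, `|Xi f| <= M%:C%C * `|f|,
        bijective Xi &
        forall k, phi k = Xi (chi k)].

(* The integers -s, ..., s. *)
Definition sym_range (s : nat) : seq int :=
  [seq k%:Z - s%:Z | k <- iota 0 s.*2.+1].

Section Truncation.
Context (phi : int * int -> H) (s t : nat).

(* V_{s,t} and S_{s,t} *)
Definition trunc_span : set H :=
  lspan [set phi k | k in [set k | k.1 \in sym_range s /\ k.2 \in sym_range t]].

Definition trunc_frame_op (f : H) : H :=
  \sum_(n <- sym_range s) \sum_(l <- sym_range t) '[f, phi (n, l)] *: phi (n, l).

End Truncation.
End Frames.

Lemma mem_sym_range (s : nat) (n : int) : (n \in sym_range s) = (`|n| <= s%:Z).
Proof.
rewrite ler_norml lerNl; apply/mapP/andP => [[k]|[sn ns]].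
  rewrite mem_iota add0n ltnS => /andP[_ ks ->]; rewrite opprB !lerBlDr lerDl.
  by rewrite -PoszD addnn !lez_nat.
have sn0 : 0 <= n + s%:Z by rewrite -lerBlDr sub0r lerNl.
exists (absz (n + s%:Z)); last by rewrite gez0_abs// addrK.
rewrite mem_iota leq0n add0n ltnS -lez_nat gez0_abs//.
by rewrite -addnn PoszD lerD2r.
Qed.

Section DotTheory.
Variables (C : numClosedFieldType) (U : lmodType C) (dot : {dot U for @Num.conj C}).

Lemma dot_CauchySchwarz u v : `|dot u v| <= sqrtC (dot u u) * sqrtC (dot v v).
Proof.
rewrite -(sqrCK (normr_ge0 _)) -sqrtCM ?nnegrE ?dnorm_ge0// ler_sqrtC
  ?nnegrE ?exprn_ge0 ?mulr_ge0 ?dnorm_ge0//.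
have [->|v0] := eqVneq v 0; first by rewrite !linear0r normr0 expr0n.
pose a := dot u v / dot v v; pose w := u - a *: v.
have wv : dot w v = 0.
  by rewrite linearBl linearZl_LR /= /a divfK ?dnorm_eq0// subrr.
have -> : u = w + a *: v by rewrite subrK.
rewrite linearDl linearZl_LR /= wv add0r normrM (ger0_norm (dnorm_ge0 _ _)).
rewrite exprMn [in leRHS]hnormDd/=; last by rewrite linearZr_LR/= wv mulr0.
by rewrite dnormZ mulrDl [X in _ * X <= _]expr2 mulrA lerDr mulr_ge0 ?dnorm_ge0.
Qed.

Lemma dot_triangle u v :
  sqrtC (dot (u + v) (u + v)) <= sqrtC (dot u u) + sqrtC (dot v v).
Proof.
rewrite -ler_sqr ?nnegrE ?addr_ge0 ?sqrtC_ge0 ?dnorm_ge0//.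
rewrite sqrrD !sqrtCK dnormD addrAC lerD2r lerD2l.
have -> : dot u v + (dot u v)^* = 'Re (dot u v) *+ 2.
  by rewrite ReE -mulr_natr divfK// pnatr_eq0.
rewrite lerMn2r/= (le_trans _ (dot_CauchySchwarz u v))//.
exact: leif_le (leif_Re_Creal _).
Qed.

End DotTheory.

Section SquareIntegrable.
Context (R : realType).
Local Notation mu := (@lebesgue_measure R).
Implicit Types f g : R -> R[i].

(* A complex function is measurable when its real and imaginary parts are. *)
Definition square_integrable f : Prop :=
  [/\ measurable_fun [set: R] (Re \o f), measurable_fun [set: R] (Im \o f) &
      (\int[mu]_x (sqnorm (f x))%:E < +oo)%E].

Lemma sqnormE (z : R[i]) : sqnorm z = Re z ^+ 2 + Im z ^+ 2.
Proof.
case: z => a b; rewrite /sqnorm normc_def -rmorphXn/= sqr_sqrtr//.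
by rewrite addr_ge0 ?sqr_ge0.
Qed.

Lemma Lfun2P (u : R -> R) : (u \in Lfun mu 2%:E) <->
  measurable_fun [set: R] u /\ (\int[mu]_x (u x ^+ 2)%:E < +oo)%E.
Proof.
split=> [uL|[mu_ ui]].
  have /integrableP[_] := Lfun2_integrable_sqr uL.
  under eq_integral do rewrite /= ger0_norm ?sqr_ge0//.
  move=> fin; split=> //.
  by move: uL => /andP[]; rewrite inE.
apply/andP; split; first by rewrite inE.
rewrite inE /= /finite_norm unlock /= poweR_lty//.
by under eq_integral do rewrite powR_mulrn ?normr_ge0// -normrX ger0_norm ?sqr_ge0//.
Qed.

Lemma square_integrableP f : square_integrable f <->
  (Re \o f \in Lfun mu 2%:E) /\ (Im \o f \in Lfun mu 2%:E).
Proof.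
have E : measurable_fun [set: R] (Re \o f) -> measurable_fun [set: R] (Im \o f) ->
  (\int[mu]_x (sqnorm (f x))%:E = \int[mu]_x ((Re \o f) x ^+ 2)%:E + \int[mu]_x ((Im \o f) x ^+ 2)%:E)%E.
  move=> mRe mIm; under eq_integral do rewrite sqnormE EFinD.
  rewrite ge0_integralD//.
  - by move=> x _; rewrite lee_fin sqr_ge0.
  - exact/measurable_EFinP/measurable_funX.
  - by move=> x _; rewrite lee_fin sqr_ge0.
  - exact/measurable_EFinP/measurable_funX.
split=> [[mRe mIm fin]|[/Lfun2P[mRe ifin] /Lfun2P[mIm fin]]].
  move: fin; rewrite E// => fin.
  split; apply/Lfun2P; split=> //; apply: le_lt_trans fin.
    by rewrite leeDl// integral_ge0// => x _; rewrite lee_fin sqr_ge0.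
  by rewrite leeDr// integral_ge0// => x _; rewrite lee_fin sqr_ge0.
by split=> //; rewrite E// lte_add_pinfty.
Qed.

Definition L2fun_pred : {pred R -> R[i]} := [pred f | `[< square_integrable f >]].

Let le12 : (1 <= 2%:E :> \bar R)%E. Proof. by rewrite lee_fin ler1n. Qed.

Lemma Lfun2Z (a b : R) (u v : R -> R) : u \in Lfun mu 2%:E -> v \in Lfun mu 2%:E ->
  (fun x => a * u x + b * v x) \in Lfun mu 2%:E.
Proof.
have [L0 LS] := @Lfun_submod_closed _ _ _ mu _ le12.
move=> uL vL; have := LS a u _ uL (LS b v _ vL L0).
by rewrite addr0.
Qed.

Lemma Lfun2D (u v : R -> R) : u \in Lfun mu 2%:E -> v \in Lfun mu 2%:E ->
  (fun x => u x + v x) \in Lfun mu 2%:E.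
Proof.
move=> uL vL; have := Lfun2Z 1 1 uL vL.
by under eq_fun do rewrite !mul1r.
Qed.

Lemma L2fun_submod_closed : submod_closed L2fun_pred.
Proof.
split.
  by apply/asboolP; apply/square_integrableP; split; exact: (@Lfun_submod_closed _ _ _ mu _ le12).1.
move=> a f g /asboolP /square_integrableP[fR fI] /asboolP /square_integrableP[gR gI].
apply/asboolP; apply/square_integrableP; split.
  have -> : Re \o (a *: f + g) =
      fun x => (Re a * (Re \o f) x + - Im a * (Im \o f) x) + (Re \o g) x.
    apply/funext => x /=; rewrite -[(a *: f + g) x]/(a * f x + g x) mulNr.
    by case: a (f x) (g x) => a b [c d] [e h].
  by apply: Lfun2D => //; exact: Lfun2Z.
have -> : Im \o (a *: f + g) =
    fun x => (Re a * (Im \o f) x + Im a * (Re \o f) x) + (Im \o g) x.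
  by apply/funext => x /=; rewrite -[(a *: f + g) x]/(a * f x + g x);
    case: a (f x) (g x) => a b [c d] [e h].
by apply: Lfun2D => //; exact: Lfun2Z.
Qed.

HB.instance Definition _ := GRing.isSubmodClosed.Build _ _ L2fun_pred
  L2fun_submod_closed.

Record L2fun := MkL2fun { L2fun_val :> R -> R[i]; _ : L2fun_val \in L2fun_pred }.

HB.instance Definition _ := [isSub for L2fun_val].
HB.instance Definition _ := [Choice of L2fun by <:].
HB.instance Definition _ := [SubChoice_isSubLmodule of L2fun by <:].

Definition L2null : {pred L2fun} :=
  [pred f : L2fun | `[< {ae mu, forall x, L2fun_val f x = 0} >] ].

Let aeF := ae_filter_ringOfSetsType mu.

Lemma L2null_zmod_closed : zmod_closed L2null.
Proof.
split; first by apply/asboolP/nearW.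
move=> f g /asboolP f0 /asboolP g0; apply/asboolP.
apply: (@filterS2 _ _ aeF _ _ _ _ f0 g0) => x /= fx gx.
by rewrite -[LHS]/(f x - g x) fx gx subr0.
Qed.

HB.instance Definition _ := GRing.isZmodClosed.Build _ L2null L2null_zmod_closed.

(* L^2(R, dx; C): square-integrable functions modulo equality a.e. *)
Definition L2 : Type := Quotient.quot L2null.
HB.instance Definition _ := GRing.Zmodule.on L2.
HB.instance Definition _ := EqQuotient.on L2.
Local Open Scope quotient_scope.

Lemma L2_eqP (f g : L2fun) :
  (\pi_L2 f = \pi_L2 g) <-> {ae mu, forall x, f x = g x}.
Proof.
have -> : (\pi_L2 f = \pi_L2 g) <-> (f - g \in L2null).
  by rewrite Quotient.idealrBE; split=> [/eqP|/eqP].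
have E x : L2fun_val (f - g) x = f x - g x by [].
split=> [/asboolP|h].
  by apply: (@filterS _ _ aeF) => x fx; apply/eqP; rewrite -subr_eq0 -E; apply/eqP.
apply/asboolP; move: h; apply: (@filterS _ _ aeF) => x fx.
by apply/eqP; rewrite [L2fun_val _ _]E fx subrr.
Qed.

Definition L2scale (a : R[i]) (u : L2) : L2 := \pi_L2 (a *: repr u).

Lemma repr_ae (f : L2fun) : {ae mu, forall x, repr (\pi_L2 f) x = f x}.
Proof. by apply/L2_eqP; rewrite reprK. Qed.

Lemma L2scale_pi a (f : L2fun) : L2scale a (\pi_L2 f) = \pi_L2 (a *: f).
Proof.
apply/L2_eqP; apply: (@filterS _ _ aeF) (repr_ae f) => x fx.
by rewrite -[LHS]/(a * repr (\pi_L2 f) x) fx.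
Qed.

Lemma L2_ind (P : L2 -> Prop) : (forall f : L2fun, P (\pi_L2 f)) -> forall u, P u.
Proof. by move=> Pf u; rewrite -[u]reprK. Qed.

Lemma pi_L2D (f g : L2fun) : \pi_L2 f + \pi_L2 g = \pi_L2 (f + g).
Proof. by rewrite !piE. Qed.

Lemma L2scaleA a b u : L2scale a (L2scale b u) = L2scale (a * b) u.
Proof. by elim/L2_ind: u => f; rewrite !L2scale_pi scalerA. Qed.
Lemma L2scale1 : left_id 1 L2scale.
Proof. by elim/L2_ind => f; rewrite !L2scale_pi scale1r. Qed.
Lemma L2scaleDr : right_distributive L2scale +%R.
Proof.
move=> a; elim/L2_ind => f; elim/L2_ind => g.
by rewrite pi_L2D !L2scale_pi pi_L2D scalerDr.
Qed.
Lemma L2scaleDl v : {morph L2scale^~ v : a b / a + b}.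
Proof.
by move=> a b; elim/L2_ind: v => f; rewrite !L2scale_pi pi_L2D scalerDl.
Qed.
HB.instance Definition _ := GRing.Zmodule_isLmodule.Build R[i] L2
  L2scaleA L2scale1 L2scaleDr L2scaleDl.

Definition Cintegral (h : R -> R[i]) : R[i] :=
  ((\int[mu]_x Re (h x)) +i* (\int[mu]_x Im (h x)))%C.

Definition Cintegrable (h : R -> R[i]) : Prop :=
  mu.-integrable setT (EFin \o (Re \o h)) /\ mu.-integrable setT (EFin \o (Im \o h)).

Lemma CintegralD h k : Cintegrable h -> Cintegrable k ->
  Cintegral (fun x => h x + k x) = Cintegral h + Cintegral k.
Proof.
move=> [hR hI] [kR kI]; rewrite /Cintegral.
under eq_Rintegral do rewrite raddfD/=.
under [X in (_ +i* X)%C]eq_Rintegral do rewrite raddfD/=.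
by rewrite !RintegralD.
Qed.

Lemma CintegralZ a h : Cintegrable h ->
  Cintegral (fun x => a * h x) = a * Cintegral h.
Proof.
move=> [hR hI]; case: a => a b; rewrite /Cintegral.
have E : (forall x, Re ((a +i* b)%C * h x) = a * Re (h x) - b * Im (h x)) /\
         (forall x, Im ((a +i* b)%C * h x) = a * Im (h x) + b * Re (h x)).
  by split=> x; case: (h x).
under eq_Rintegral do rewrite E.1.
under [X in (_ +i* X)%C]eq_Rintegral do rewrite E.2.
have Z c (k : R -> R) : mu.-integrable setT (EFin \o k) ->
    mu.-integrable setT (EFin \o (fun x => c * k x)).
  exact: integrableZl.
by rewrite RintegralB ?RintegralD ?Z// !RintegralZl.
Qed.

Lemma CintegralJ h : Cintegrable h ->
  Cintegral (fun x => (h x)^*%C) = (Cintegral h)^*%C.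
Proof.
move=> [hR hI]; rewrite /Cintegral /=.
have E : (forall x, Re (h x)^*%C = Re (h x)) /\
         (forall x, Im (h x)^*%C = - 1 * Im (h x)).
  by split=> x; case: (h x) => // c d; rewrite mulN1r.
under eq_Rintegral do rewrite E.1.
under [X in (_ +i* X)%C]eq_Rintegral do rewrite E.2.
by rewrite RintegralZl// mulN1r.
Qed.

Lemma eq_ae_Cintegral h k : measurable_fun setT (Re \o h) ->
  measurable_fun setT (Im \o h) ->
  measurable_fun setT (Re \o k) -> measurable_fun setT (Im \o k) ->
  {ae mu, forall x, h x = k x} -> Cintegral h = Cintegral k.
Proof.
move=> hR hI kR kI hk; rewrite /Cintegral /Rintegral.
congr (fine _ +i* fine _)%C; apply: ae_eq_integral => //;
  try exact/measurable_EFinP;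
  by apply: (@filterS _ _ aeF) hk => x /= -> _.
Qed.

Definition L2fdot (f g : L2fun) : R[i] := Cintegral (fun x => f x * (g x)^*%C).

Lemma L2funP (f : L2fun) : square_integrable f.
Proof. by case: f => f fP; exact/asboolP. Qed.

Lemma L2fun_Lfun (f : L2fun) :
  (Re \o f \in Lfun mu 2%:E) /\ (Im \o f \in Lfun mu 2%:E).
Proof. exact/square_integrableP/L2funP. Qed.

Lemma integrable_L2fdot (f g : L2fun) : Cintegrable (fun x => f x * (g x)^*%C).
Proof.
have [fR fI] := L2fun_Lfun f; have [gR gI] := L2fun_Lfun g.
split.
  have -> : Re \o (fun x => f x * (g x)^*%C) =
     ((Re \o f) \* (Re \o g)) \+ ((Im \o f) \* (Im \o g)).
    apply/funext => x /=; case: (f x) (g x) => a b [c d] /=.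
    by rewrite mulrN opprK.
  rewrite (_ : EFin \o _ = (EFin \o ((Re \o f) \* (Re \o g))%R)
    \+ (EFin \o ((Im \o f) \* (Im \o g))%R))%E//.
  by apply: integrableD => //; apply/Lfun1_integrable; exact: Lfun2_mul_Lfun1.
have -> : Im \o (fun x => f x * (g x)^*%C) =
   ((Im \o f) \* (Re \o g)) \- ((Re \o f) \* (Im \o g)).
  apply/funext => x /=; case: (f x) (g x) => a b [c d] /=.
  by rewrite mulrN addrC.
rewrite (_ : EFin \o _ = (EFin \o ((Im \o f) \* (Re \o g))%R)
  \- (EFin \o ((Re \o f) \* (Im \o g))%R))%E//.
by apply: integrableB => //; apply/Lfun1_integrable; exact: Lfun2_mul_Lfun1.
Qed.

Definition L2dot (u v : L2) : R[i] := L2fdot (repr u) (repr v).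

Lemma L2dot_pi (f g : L2fun) : L2dot (\pi_L2 f) (\pi_L2 g) = L2fdot f g.
Proof.
have mC (h k : L2fun) := integrable_L2fdot h k.
apply: eq_ae_Cintegral; try by apply/measurable_EFinP; apply: (measurable_int mu); apply mC.
apply: (@filterS2 _ _ aeF _ _ _ _ (repr_ae f) (repr_ae g)) => x fx gx.
by congr (_ * conjc _).
Qed.

Lemma L2fdotC (f g : L2fun) : L2fdot f g = (L2fdot g f)^*%C.
Proof.
rewrite -CintegralJ; last exact: integrable_L2fdot.
by congr Cintegral; apply/funext => x; rewrite rmorphM/= conjcK mulrC.
Qed.

Lemma L2fdotP a (f g h : L2fun) : L2fdot (a *: f + g) h = a * L2fdot f h + L2fdot g h.
Proof.
rewrite /L2fdot -CintegralZ -?CintegralD; try exact: integrable_L2fdot.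
  congr Cintegral; apply/funext => x.
  by rewrite -[L2fun_val (_ + _) x]/(a * f x + g x) mulrDl mulrA.
have := integrable_L2fdot (a *: f) h; congr Cintegrable.
by apply/funext => x; rewrite -[L2fun_val (_ *: _) x]/(a * f x) mulrA.
Qed.

Lemma L2dotC u v : L2dot u v = (L2dot v u)^*%C.
Proof. exact: L2fdotC. Qed.

Lemma L2dotP a u v w : L2dot (a *: u + v) w = a * L2dot u w + L2dot v w.
Proof.
elim/L2_ind: u => f; elim/L2_ind: v => g; elim/L2_ind: w => h.
have -> : a *: \pi_L2 f + \pi_L2 g = \pi_L2 (a *: f + g).
  by rewrite -pi_L2D -L2scale_pi.
by rewrite !L2dot_pi L2fdotP.
Qed.

Lemma L2dot_bilinear : bilinear_for *%R (Num.conj \; *%R) L2dot.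
Proof.
split=> [u a v w|u a v w]; first exact: L2dotP.
by rewrite L2dotC L2dotP (L2dotC u v) (L2dotC u w) -[LHS]/(Num.conj _) rmorphD rmorphM.
Qed.
HB.instance Definition _ := bilinear_isBilinear.Build R[i] L2 L2 R[i]
  *%R (Num.conj \; *%R) L2dot L2dot_bilinear.

Lemma L2dot_hermitian u v : L2dot u v = (-1) ^+ false * Num.conj (L2dot v u).
Proof. by rewrite mul1r; exact: L2dotC. Qed.
HB.instance Definition _ := isHermitianSesquilinear.Build R[i] L2 false
  Num.conj L2dot L2dot_hermitian.

Lemma L2fdotE (f : L2fun) : L2fdot f f = (\int[mu]_x sqnorm (f x))%:C%C.
Proof.
rewrite /L2fdot /Cintegral; congr (_ +i* _)%C.
  apply: eq_Rintegral => x _; rewrite sqnormE; case: (f x) => a b /=.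
  by rewrite mulrN opprK !expr2.
under eq_Rintegral.
  move=> x _; rewrite (_ : Im _ = 0); last first.
    by case: (f x) => a b /=; rewrite mulrN mulrC addNr.
  over.
by rewrite Rintegral_cst// mul0r.
Qed.

Lemma L2dot_neq0 (u : L2) : u != 0 -> 0 < L2dot u u.
Proof.
elim/L2_ind: u => f f0; rewrite L2dot_pi L2fdotE ltcR lt0r.
rewrite Rintegral_ge0 ?andbT; last first.
  by move=> x _; rewrite sqnormE addr_ge0 ?sqr_ge0.
apply: contra f0 => /eqP f0; apply/eqP.
have [mR mI fin] := L2funP f.
have m2 : measurable_fun setT (fun x => (sqnorm (f x))%:E).
  apply/measurable_EFinP; under eq_fun do rewrite sqnormE.
  by apply: measurable_funD; exact: measurable_funX.
have : (\int[mu]_x `|(sqnorm (f x))%:E| = 0)%E.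
  under eq_integral.
    move=> x _; rewrite gee0_abs ?lee_fin; last first.
      by rewrite sqnormE addr_ge0 ?sqr_ge0.
    over.
  rewrite -[LHS]fineK; first by rewrite [fine _]f0.
  rewrite ge0_fin_numE// integral_ge0// => x _.
  by rewrite lee_fin sqnormE addr_ge0 ?sqr_ge0.
move/(ae_eq_integral_abs mu measurableT m2) => f20.
have -> : 0 = \pi_L2 0 by rewrite piE.
apply/L2_eqP; apply: (@filterS _ _ aeF) f20 => x /(_ I) [].
rewrite sqnormE => /eqP; rewrite paddr_eq0 ?sqr_ge0// !sqrf_eq0.
by case: (L2fun_val f x) => c d /= /andP[/eqP -> /eqP ->].
Qed.
HB.instance Definition _ := isDotProduct.Build R[i] L2 L2dot L2dot_neq0.

Definition L2norm (u : L2) : R[i] := sqrtC (L2dot u u).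

Lemma L2norm_triangle u v : L2norm (u + v) <= L2norm u + L2norm v.
Proof. exact: (dot_triangle L2dot). Qed.

Lemma L2normZ a u : L2norm (a *: u) = `|a| * L2norm u.
Proof.
rewrite /L2norm dnormZ sqrtCM ?nnegrE ?exprn_ge0 ?dnorm_ge0//.
by rewrite sqrCK.
Qed.

Lemma L2norm_eq0 u : L2norm u = 0 -> u = 0.
Proof. by move/eqP; rewrite sqrt_dnorm_eq0 => /eqP. Qed.

HB.instance Definition _ := Lmodule_isNormed.Build R[i] L2
  L2norm_triangle L2normZ L2norm_eq0.

Lemma L2_inner_norm (u : L2) : `|u| ^+ 2 = L2dot u u.
Proof. exact: sqrtCK. Qed.

HB.instance Definition _ := NormedModule_isPreHilbert.Build R L2 L2_inner_norm.

Lemma lebesgue_measure_shift (a : R) (A : set R) : measurable A ->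
  pushforward mu ((fun x => x - a) : R -> measurableTypeR R) A = mu A.
Proof.
have ms : measurable_fun setT ((fun x => x - a) : R -> measurableTypeR R).
  exact: measurable_funB.
move=> mA; apply/esym/lebesgue_measure_unique => //= _ [[b c]] _ <-.
rewrite /pushforward (_ : _ @^-1` _ = `]b + a, c + a]%classic); last first.
  by apply/seteqP; split=> x; rewrite /= !in_itv/= ltrBrDr lerBlDr.
rewrite !lebesgue_measure_itv/= !lte_fin ltrD2r.
by rewrite -!EFinB opprD addrACA subrr addr0.
Qed.

Definition shift_fun (a : R) (f : R -> R[i]) : R -> R[i] := fun x => f (x - a).

Lemma ge0_integral_shift (a : R) (g : R -> \bar R) :
  measurable_fun setT g -> (forall x, 0 <= g x)%E ->
  (\int[mu]_x g (x - a)%R = \int[mu]_x g x)%E.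
Proof.
move=> mg g0.
have ms : measurable_fun setT ((fun x => x - a) : R -> measurableTypeR R).
  exact: measurable_funB.
have := @ge0_integral_pushforward _ _ (measurableTypeR R) (measurableTypeR R) R
  _ ms mu setT g measurableT mg (fun x _ => g0 x).
rewrite preimage_setT => <-.
apply: eq_measure_integral => A mA _; exact: lebesgue_measure_shift.
Qed.

Lemma shift_fun_L2 (a : R) (f : L2fun) : shift_fun a f \in L2fun_pred.
Proof.
have [mR mI fin] := L2funP f.
have ms : measurable_fun setT ((fun x => x - a) : R -> measurableTypeR R).
  exact: measurable_funB.
have m2 : measurable_fun setT (fun x => (sqnorm (f x))%:E).
  apply/measurable_EFinP; under eq_fun do rewrite sqnormE.
  by apply: measurable_funD; exact: measurable_funX.
apply/asboolP; split.
- exact: (measurableT_comp mR ms).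
- exact: (measurableT_comp mI ms).
- rewrite (ge0_integral_shift a m2)// => x.
  by rewrite lee_fin sqnormE addr_ge0 ?sqr_ge0.
Qed.

Definition translation (a : R) (u : L2) : L2 :=
  \pi_L2 (MkL2fun (shift_fun_L2 a (repr u))).

Lemma translation_pi (a : R) (f : L2fun) :
  translation a (\pi_L2 f) = \pi_L2 (MkL2fun (shift_fun_L2 a f)).
Proof.
apply/L2_eqP.
have /= := repr_ae f.
have ms : measurable_fun setT ((fun x => x - a) : R -> measurableTypeR R).
  exact: measurable_funB.
move=> [N [mN N0 sN]]; exists ((fun x => x - a) @^-1` N); split.
- by rewrite -[X in measurable X]setTI; exact: ms.
- by rewrite -N0; exact: lebesgue_measure_shift.
- by move=> x /= h; apply: sN.
Qed.
End SquareIntegrable.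

Section NonstationaryTranslates.
Context (R : realType).

(* The family T_{n q_l} phi_l, indexed by the pairs (n, l). *)
Definition translates (q : int -> R) (phi : int -> L2 R) (k : int * int) : L2 R :=
  translation (k.1%:~R * q k.2) (phi k.2).

End NonstationaryTranslates.

(* Main.v *)
Require Import Defs.
From HB Require Import structures.
From mathcomp Require Import all_boot all_order all_algebra.
From mathcomp Require Import sesquilinear complex.
From mathcomp Require Import all_classical all_reals all_analysis.
From mathcomp Require Import measurable_realfun finmap ring lra.

(* By linear independence the vectors S_{s,t}^{-1} phi_k are biorthogonal to the
   phi_j in the truncated family, so by the hypothesis the limit vectors g_k are
   biorthogonal to the whole family; it does not matter here that g_k is
   S^{-1} phi_k.  A frame with a biorthogonal family is a Riesz basis: let chi be
   the Gram-Schmidt orthonormalization of phi and Xi f = sum_k <f, chi_k> phi_k.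
   Then Xi is bounded because phi is a Bessel family, injective because
   <Xi f, g_k> = <f, chi_k>, and surjective because Xi Xi^* is the frame
   operator, which is coercive.  The sums converge because L^2 is complete. *)

Import Order.TTheory GRing.Theory Num.Theory.
Import numFieldNormedType.Exports.

Local Open Scope classical_set_scope.
Local Open Scope ring_scope.

Set Implicit Arguments.
Unset Strict Implicit.
Unset Printing Implicit Defensive.

Local Notation Re := (@complex.Re _).
Local Notation Im := (@complex.Im _).

(** * Squared norms and Bessel sequences *)

Section PreHilbertTheory.
Context (R : realType) (H : preHilbertType R).
Implicit Types (x y z : H) (a : R[i]).

Lemma sqnorm_ge0 (V : normedZmodType R[i]) (x : V) : 0 <= sqnorm x.
Proof.
have : 0 <= `|x| ^+ 2 by rewrite exprn_ge0.
by rewrite /sqnorm lecE => /andP[].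
Qed.

Lemma sqnormC (V : normedZmodType R[i]) (x : V) : (sqnorm x)%:C%C = `|x| ^+ 2.
Proof. by rewrite /sqnorm RRe_real// ger0_real// exprn_ge0. Qed.

Lemma sqnorm_inner x : '[x, x] = (sqnorm x)%:C%C.
Proof. by rewrite sqnormC inner_norm. Qed.

Lemma sqnorm0 (V : normedZmodType R[i]) : sqnorm (0 : V) = 0.
Proof. by rewrite /sqnorm normr0 expr0n. Qed.

Lemma sqnorm_eq0 (V : normedZmodType R[i]) (x : V) : sqnorm x = 0 -> x = 0.
Proof.
move=> x0; apply/eqP; rewrite -normr_eq0 -sqrf_eq0 -sqnormC x0.
by rewrite rmorph0.
Qed.

Lemma sqnormN (V : normedZmodType R[i]) (x : V) : sqnorm (- x) = sqnorm x.
Proof. by rewrite /sqnorm normrN. Qed.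

Lemma normC_sqnorm (V : normedZmodType R[i]) (x : V) :
  `|x| = (Num.sqrt (sqnorm x))%:C%C.
Proof.
apply/eqP; rewrite -(@eqrXn2 _ 2) ?ler0c ?sqrtr_ge0 ?normr_ge0//.
by rewrite -rmorphXn/= sqr_sqrtr ?sqnorm_ge0// sqnormC.
Qed.

Lemma sqnormZ a x : sqnorm (a *: x) = sqnorm a * sqnorm x.
Proof.
by apply: complexI; rewrite rmorphM/= !sqnormC normrZ exprMn.
Qed.

Lemma innerC x y : '[x, y] = ('[y, x])^*%C.
Proof. by rewrite (hermC inner) /= mul1r. Qed.

Lemma sqnorm_innerC x y : sqnorm '[x, y] = sqnorm '[y, x].
Proof. by rewrite innerC !sqnormE; case: '[y, x] => b c /=; rewrite sqrrN. Qed.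

Lemma sqnormD x y : sqnorm (x + y) = sqnorm x + sqnorm y + 2 * Re '[x, y].
Proof.
apply: complexI; rewrite -sqnorm_inner dnormD !rmorphD/= -!sqnorm_inner.
by congr (_ + _); rewrite addcJ rmorphM/= rmorph_nat.
Qed.

Lemma sqnormB x y : sqnorm (x - y) = sqnorm x + sqnorm y - 2 * Re '[x, y].
Proof. by rewrite sqnormD sqnormN linearNr raddfN/= mulrN. Qed.

Lemma inner_CauchySchwarz x y : sqnorm '[x, y] <= sqnorm x * sqnorm y.
Proof.
have := dot_CauchySchwarz inner x y.
rewrite -ler_sqr ?nnegrE ?mulr_ge0 ?sqrtC_ge0 ?dnorm_ge0// exprMn !sqrtCK.
by rewrite !sqnorm_inner -sqnormC -rmorphM lecR.
Qed.

Lemma sqnormD_le (V : normedZmodType R[i]) (x y : V) :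
  sqnorm (x + y) <= 2 * sqnorm x + 2 * sqnorm y.
Proof.
have r (z : V) : exists2 r : R, 0 <= r & `|z| = r%:C%C.
  exists (Re `|z|); last by rewrite RRe_real// ger0_real.
  by have := normr_ge0 z; rewrite lecE => /andP[].
have [a a0 ea] := r x; have [b b0 eb] := r y; have [c c0 ec] := r (x + y).
have : `|x + y| <= `|x| + `|y| by apply: ler_normD.
rewrite /sqnorm ea eb ec -!rmorphXn/= -rmorphD lecR => cab.
have : c ^+ 2 <= (a + b) ^+ 2 by rewrite ler_sqr ?nnegrE ?addr_ge0.
by have := sqr_ge0 (a - b); lra.
Qed.

(** Weighted Young inequality: the right side exceeds the left by the squared modulus of
    [b * c - conj z], divided by [b]. *)
Lemma ReM_le (c z : R[i]) (b : R) : 0 < b ->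
  2 * Re (c * z) <= b * sqnorm c + sqnorm z / b.
Proof.
move=> b0; rewrite !sqnormE; case: c z => c1 c2 [z1 z2] /=.
have -> : b * (c1 ^+ 2 + c2 ^+ 2) + (z1 ^+ 2 + z2 ^+ 2) / b =
    2 * (c1 * z1 - c2 * z2) + ((b * c1 - z1) ^+ 2 + (b * c2 + z2) ^+ 2) / b.
  by field; rewrite gt_eqF.
by rewrite lerDl divr_ge0 ?addr_ge0 ?sqr_ge0// ltW.
Qed.

Lemma sqnorm_eps (V : normedZmodType R[i]) (x : V) (C : R) :
  (forall e, 0 < e -> sqnorm x <= e * C) -> x = 0.
Proof.
move=> h; apply: sqnorm_eq0; apply/eqP; rewrite eq_le sqnorm_ge0 andbT.
have [C0|C0] := leP C 0.
  by rewrite (le_trans (h 1 ltr01))// mul1r.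
apply/ler_addgt0Pr => e e0; rewrite add0r.
by have := h (e / C) (divr_gt0 e0 C0); rewrite divfK// gt_eqF.
Qed.

End PreHilbertTheory.

(** * Limits in pre-Hilbert spaces and Bessel series *)

Section Convergence.
Context (R : realType).

(** Norms and radii live in [R[i]]; this criterion lets later estimates be done over [R]. *)
Lemma cvg_sqnormP (V : normedModType R[i]) (u : nat -> V) (l : V) :
  u @ \oo --> l <->
  forall e : R, 0 < e -> \forall n \near \oo, sqnorm (u n - l) <= e.
Proof.
split=> [/cvgrPdist_le cu e e0|h].
  have se : 0 < (Num.sqrt e)%:C%C by rewrite ltcR sqrtr_gt0.
  near=> n; have : `|l - u n| <= (Num.sqrt e)%:C%C by near: n; exact: cu.
  by rewrite distrC normC_sqnorm lecR ler_sqrt// ltW.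
apply/cvgrPdist_le => e e0.
have [r er] : exists r : R, e = r%:C%C.
  by exists (Re e); rewrite RRe_real// gtr0_real.
move: e0; rewrite er ltcR => r0; near=> n.
have : sqnorm (u n - l) <= r ^+ 2 by near: n; apply: h; rewrite exprn_gt0.
rewrite distrC normC_sqnorm lecR => /ler_wsqrtr/le_trans; apply.
by rewrite sqrtr_sqr ger0_norm// ltW.
Unshelve. all: by end_near. Qed.

Context (H : preHilbertType R).
Implicit Types (u : nat -> H) (x y h : H).

Lemma cvg_innerl u x h : u @ \oo --> x ->
  ('[u n, h] : R[i]^o) @[n --> \oo] --> ('[x, h] : R[i]^o).
Proof.
move=> /cvg_sqnormP ux; apply/cvg_sqnormP => e e0.
(* The summand [1] keeps the divisor positive when [h] is [0]. *)
have h1 : 0 < 1 + sqnorm h by rewrite ltr_pwDl ?sqnorm_ge0.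
near=> n; rewrite -(linearBl inner).
apply: le_trans (inner_CauchySchwarz _ _) _.
have : sqnorm (u n - x) <= e / (1 + sqnorm h).
  by near: n; apply: ux; rewrite divr_gt0.
rewrite ler_pdivlMr//; apply: le_trans.
by rewrite ler_wpM2l ?sqnorm_ge0// lerDr.
Unshelve. all: by end_near. Qed.

Lemma cvg_innerr u x h : u @ \oo --> x ->
  ('[h, u n] : R[i]^o) @[n --> \oo] --> ('[h, x] : R[i]^o).
Proof.
move=> /(@cvg_innerl _ _ h)/cvg_sqnormP ux; apply/cvg_sqnormP => e /ux.
apply: filterS => n; rewrite -(linearBl inner) -(linearBr inner) => ?.
by rewrite sqnorm_innerC.
Qed.

Lemma cvg_sqnorm_le u x (C : R) : u @ \oo --> x ->
  (forall n, sqnorm (u n) <= C) -> sqnorm x <= C.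
Proof.
move=> /cvg_sqnormP ux uC.
have C0 : 0 <= C by rewrite (le_trans _ (uC 0%N))// sqnorm_ge0.
suff : Num.sqrt (sqnorm x) <= Num.sqrt C by rewrite ler_sqrt.
apply/ler_addgt0Pr => e e0.
have /ux[N _ /(_ N (leqnn N))] : 0 < e ^+ 2 by rewrite exprn_gt0.
rewrite /= -sqnormN opprB => /ler_wsqrtr; rewrite sqrtr_sqr gtr0_norm// => xe.
have := ler_normD (u N) (x - u N); rewrite subrKC !normC_sqnorm -rmorphD lecR.
move/le_trans; apply; rewrite lerD//.
by apply: ler_wsqrtr; exact: uC.
Qed.

(** [preHilbertType] does not include completeness, so it is carried as a hypothesis. *)
Definition sqnorm_complete : Prop := forall u,
  (forall e : R, 0 < e ->
     exists N, forall m n, (N <= m <= n)%N -> sqnorm (u n - u m) <= e) ->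
  cvgn u.

(** Bounding finite blocks avoids infinite sums. *)
Definition bessel_seq (b : R) (v : nat -> H) : Prop :=
  forall m n h, \sum_(m <= k < n) sqnorm '[h, v k] <= b * sqnorm h.

(** Synthesis is adjoint to analysis and inherits its bound. With [y] the sum, [ReM_le] on each term
    of [2 |y|^2] and the Bessel bound at [y] leave one [|y|^2] to absorb. *)
Lemma bessel_seq_synthesis (b : R) (v : nat -> H) (c : nat -> R[i]) m n :
  0 < b -> bessel_seq b v ->
  sqnorm (\sum_(m <= k < n) c k *: v k) <= b * \sum_(m <= k < n) sqnorm (c k).
Proof.
move=> b0 bv; set y := \sum_(m <= k < n) _.
suff : 2 * sqnorm y <= b * \sum_(m <= k < n) sqnorm (c k) + sqnorm y by lra.
have -> : 2 * sqnorm y = \sum_(m <= k < n) 2 * Re (c k * '[v k, y]).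
  rewrite -mulr_sumr; congr (_ * _).
  rewrite -(raddf_sum (@complex.Re R : Rcomplex R -> R)).
  have -> : \sum_(m <= k < n) (c k * '[v k, y] : Rcomplex R) = '[y, y].
    rewrite {3}/y (linear_sumlz inner).
    by apply: eq_bigr => k _; rewrite (linearZl_LR inner).
  by rewrite sqnorm_inner.
apply: (@le_trans _ _ (\sum_(m <= k < n)
    (b * sqnorm (c k) + sqnorm '[v k, y] / b))).
  by apply: ler_sum => k _; exact: ReM_le.
rewrite big_split/= -mulr_sumr lerD2l -mulr_suml ler_pdivrMr// mulrC.
by under eq_bigr do rewrite sqnorm_innerC; exact: bv.
Qed.

(** Blocks of the vector series are dominated by blocks of the series of [sqnorm (c k)], which
    converges because it is monotone and bounded. *)
Lemma cvg_bessel_series (b C : R) (v : nat -> H) (c : nat -> R[i]) :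
  sqnorm_complete -> 0 < b -> bessel_seq b v ->
  (forall n, \sum_(0 <= k < n) sqnorm (c k) <= C) ->
  cvgn (fun n => \sum_(0 <= k < n) c k *: v k).
Proof.
move=> cH b0 bv cC; apply: cH => e e0.
pose s n := \sum_(0 <= k < n) sqnorm (c k).
have sE m n : (m <= n)%N -> s n - s m = \sum_(m <= k < n) sqnorm (c k).
  by move=> mn; apply/eqP; rewrite subr_eq addrC; apply/eqP/big_cat_nat.
have ss : {homo s : m n / (m <= n)%N >-> m <= n}.
  by move=> m n mn; rewrite -subr_ge0 sE// sumr_ge0// => k _; exact: sqnorm_ge0.
have cs : cvgn s.
  by apply: nondecreasing_is_cvgn => //; exists C => _ [n _ <-]; exact: cC.
have sl n : s n <= limn s by exact: nondecreasing_cvgn_le.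
have := cs; move/cvgrPdist_le => /(_ (e / b)) [|N _ hN]; first by rewrite divr_gt0.
exists N => m n /andP[Nm mn].
rewrite (big_cat_nat (leq0n m) mn)//=.
rewrite [X in X - _]addrC addrK.
apply: (le_trans (bessel_seq_synthesis _ _ _ b0 bv)).
rewrite mulrC -ler_pdivlMr// -sE//.
have := hN _ Nm => /=; rewrite ger0_norm ?subr_ge0//; apply: le_trans.
by rewrite lerD2r.
Qed.

(** Norms at most 1, rather than equal to 1, admit the zero vectors that Gram-Schmidt may produce.
    The bound follows by expanding [|h - p r|^2 >= 0]. *)
Lemma bessel_inequality (I : eqType) (r : seq I) (v : I -> H) h : uniq r ->
  (forall i j, i != j -> '[v i, v j] = 0) -> (forall i, sqnorm (v i) <= 1) ->
  \sum_(i <- r) sqnorm '[h, v i] <= sqnorm h.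
Proof.
move=> ur vo v1; pose p s := \sum_(i <- s) '[h, v i] *: v i.
have hp : '[h, p r] = (\sum_(i <- r) sqnorm '[h, v i])%:C%C.
  rewrite (linear_sumr inner) rmorph_sum; apply: eq_bigr => i _.
  by rewrite (linearZr_LR inner)/= mulrC sqnormC sqr_normc.
have pp : sqnorm (p r) <= \sum_(i <- r) sqnorm '[h, v i].
  elim: r ur {hp} => [|i r IHr] /=; first by rewrite /p !big_nil sqnorm0.
  move=> /andP[ir ur]; rewrite /p !big_cons sqnormD sqnormZ.
  have -> : '['[h, v i] *: v i, \sum_(j <- r) '[h, v j] *: v j] = 0.
    rewrite (linear_sumr inner) big_seq big1// => j jr.
    rewrite (linearZr_LR inner)/= (linearZl_LR inner)/= vo ?mulr0//.
    by apply: contraNneq ir => ->.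
  by rewrite mulr0 addr0 lerD ?IHr// ler_piMr ?sqnorm_ge0.
have := sqnorm_ge0 (h - p r); rewrite sqnormB hp /=; lra.
Qed.

End Convergence.

(** * Coercive operators *)

Section Coercive.
Context (R : realType) (H : preHilbertType R).
Implicit Types x y : H.

Lemma sqnormBZ (r : R) x y : sqnorm (x - r%:C%C *: y) =
  sqnorm x + r ^+ 2 * sqnorm y - 2 * r * Re '[x, y].
Proof.
rewrite sqnormB sqnormZ (linearZr_LR inner)/= sqnormE/= expr0n addr0 -mulrA.
congr (_ - 2 * _); rewrite -[Num.conj]/(@conjc R) conjc_real.
by case: '[x, y] => c d /=; rewrite mul0r subr0.
Qed.

(* The damped iteration [y + (h - S y) / b] contracts the residual, since
   [|e - S e / b|^2 <= |e|^2 - Re <S e, e> / b]. *)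
Lemma coercive_surjective (S : {linear H -> H}) (a b : R) :
  sqnorm_complete H -> 0 < a -> 0 < b ->
  (forall x, a * sqnorm x <= Re '[S x, x]) ->
  (forall x, sqnorm (S x) <= b * Re '[S x, x]) ->
  forall h, exists x, S x = h.
Proof.
move=> cH a0 b0 aS Sb h.
(* Expand [|S x - a x|^2 >= 0]; the upper bound [Sle] comes in the same way from
   [|S x - b x|^2 >= 0]. *)
have Sge x : a ^+ 2 * sqnorm x <= sqnorm (S x).
  have := sqnorm_ge0 (S x - a%:C%C *: x); rewrite sqnormBZ.
  by have := aS x; rewrite -(ler_pM2l a0); lra.
have Sle x : sqnorm (S x) <= b ^+ 2 * sqnorm x.
  have := sqnorm_ge0 (S x - b%:C%C *: x); rewrite sqnormBZ.
  by have := Sb x; lra.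
pose y n := iter n (fun z => z + b^-1%:C%C *: (h - S z)) 0.
(* The natural factor [1 - a / b] could be negative, as [a <= b] is not assumed; [r] exceeds it by
   [a^2 / (b (a + b))] and always lies strictly between 0 and 1. *)
pose r := b / (a + b).
have ab0 : 0 < a + b by rewrite addr_gt0.
have r01 : `|r| < 1.
  by rewrite ger0_norm ?divr_ge0 ?ltW// ltr_pdivrMr// mul1r ltrDr.
have resE n : h - S (y n.+1) = (h - S (y n)) - b^-1%:C%C *: S (h - S (y n)).
  by rewrite /y iterS linearD linearZ /= opprD addrA.
have res n : sqnorm (h - S (y n)) <= r ^+ n * sqnorm h.
  elim: n => [|n IHn]; first by rewrite /y/= linear0 subr0 expr0 mul1r.
  rewrite resE; set e := h - S (y n).
  rewrite exprS -mulrA (le_trans _ (ler_wpM2l _ IHn))//; last first.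
    by rewrite divr_ge0 ?ltW.
  rewrite sqnormBZ innerC; set t := Re _.
  have -> : t = Re '[S e, e] by rewrite /t; case: '[S e, e].
  apply: (@le_trans _ _ (sqnorm e - b^-1 * Re '[S e, e])).
    have : b^-1 ^+ 2 * sqnorm (S e) <= b^-1 * Re '[S e, e].
      rewrite expr2 -mulrA ler_pM2l ?invr_gt0// -ler_pdivlMl ?invr_gt0//.
      by rewrite invrK.
    lra.
  apply: (@le_trans _ _ (sqnorm e - b^-1 * (a * sqnorm e))).
    by rewrite lerD2l lerN2 ler_pM2l ?invr_gt0.
  rewrite -[X in X - _]mul1r mulrA -mulrBl ler_wpM2r ?sqnorm_ge0//.
  rewrite -subr_ge0 (_ : _ - _ = b^-1 * a ^+ 2 / (a + b)).
    by rewrite divr_ge0 ?mulr_ge0 ?invr_ge0 ?sqr_ge0 ?ltW.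
  by rewrite /r; field; rewrite ?gt_eqF.
have res0 : r ^+ n * sqnorm h @[n --> \oo] --> 0.
  by rewrite -[X in _ --> X](mul0r (sqnorm h)); apply: cvgMr_tmp; exact: cvg_expr.
have res_small e : 0 < e -> \forall n \near \oo, sqnorm (h - S (y n)) <= e.
  move=> e0; move/cvgrPdist_le : res0 => /(_ e e0); apply: filterS => n.
  rewrite sub0r normrN; apply: le_trans; rewrite (le_trans (res n))//.
  exact: ler_norm.
have cy : cvgn y.
  apply: cH => e e0.
  (* [Sge] costs the factor [a ^+ 2], and [sqnormD_le] on two residuals costs the 4. *)
  have [|N _ hN] := res_small (a ^+ 2 * e / 4).
    by rewrite divr_gt0// mulr_gt0// exprn_gt0.
  exists N => m n /andP[Nm mn].
  rewrite -(ler_pM2l (exprn_gt0 2 a0)) (le_trans (Sge _))//.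
  rewrite linearB -[S (y n) - _](subrKA h).
  rewrite (le_trans (sqnormD_le _ _))//.
  rewrite -(opprB h) sqnormN.
  have := hN n (leq_trans Nm mn); have := hN m Nm => /=; lra.
exists (limn y); apply/eqP; rewrite -subr_eq0; apply/eqP.
(* The part [2 * b ^+ 2] pays for [S (y n - limn y)] through [Sle], the part [2] for the
   residual. *)
apply: (@sqnorm_eps _ _ _ (2 * b ^+ 2 + 2)) => e e0.
have /cvg_sqnormP/(_ e e0) [N1 _ h1] := cy.
have [N2 _ h2] := res_small e e0.
pose n := maxn N1 N2.
have := h1 n (leq_maxl _ _); have := h2 n (leq_maxr _ _) => /= h2n h1n.
rewrite (_ : S (limn y) - h = - (S (y n - limn y) + (h - S (y n)))); last first.
  by rewrite linearB/= [in RHS]addrC subrKA opprB.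
rewrite sqnormN (le_trans (sqnormD_le _ _))//.
have := Sle (y n - limn y).
have : b ^+ 2 * sqnorm (y n - limn y) <= b ^+ 2 * e.
  by rewrite ler_wpM2l ?sqr_ge0.
lra.
Qed.

End Coercive.

(** * Analysis along one Bessel sequence followed by synthesis along another *)

Section Transfer.
Context (R : realType) (H : preHilbertType R).
Hypothesis cH : sqnorm_complete H.
Variables (b1 b2 : R) (e v : nat -> H).
Hypotheses (b1_gt0 : 0 < b1) (b2_gt0 : 0 < b2).
Hypotheses (be : bessel_seq b1 e) (bv : bessel_seq b2 v).
Implicit Types f h : H.

Definition transfer_sum f n := \sum_(0 <= k < n) '[f, e k] *: v k.

(** Used three times: from [psi] to [u] it is [Xi], from [u] to [psi] the adjoint [W], from [psi] to
    [psi] the orthogonal expansion. *)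
Definition transfer f : H := limn (transfer_sum f).

Lemma cvg_transfer f : transfer_sum f @ \oo --> transfer f.
Proof.
by apply: (cvg_bessel_series (b := b2) (C := b1 * sqnorm f)).
Qed.

Lemma sqnorm_transfer f : sqnorm (transfer f) <= b2 * b1 * sqnorm f.
Proof.
apply: (cvg_sqnorm_le (cvg_transfer (f := f))) => n.
rewrite (le_trans (bessel_seq_synthesis _ _ _ b2_gt0 bv))//.
by rewrite -mulrA ler_pM2l//; exact: be.
Qed.

Lemma transfer_is_linear : linear transfer.
Proof.
move=> a f h.
have c : transfer_sum (a *: f + h) @ \oo --> a *: transfer f + transfer h.
  have -> : transfer_sum (a *: f + h) =
      (fun n => a *: transfer_sum f n + transfer_sum h n).
    apply/funext => n; rewrite /transfer_sum scaler_sumr -big_split/=.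
    apply: eq_bigr => k _.
    by rewrite (linearDl inner) (linearZl_LR inner)/= scalerDl scalerA.
  apply: cvgD; last exact: cvg_transfer.
  by apply: cvgZl_tmp; exact: cvg_transfer.
exact: cvg_lim c.
Qed.

Lemma transfer_single f n : (forall k, k != n -> '[f, e k] = 0) ->
  transfer f = '[f, e n] *: v n.
Proof.
move=> fe; apply: cvg_lim => //; apply: cvg_near_cst.
exists n.+1 => // m /= nm; apply/eqP; rewrite /transfer_sum.
rewrite (bigD1_seq n) ?mem_index_iota ?iota_uniq//= big1 ?addr0// => k kn.
by rewrite fe// scale0r.
Qed.

End Transfer.

(** The partial sums satisfy the identity term by term, and limits are unique. *)
Lemma transfer_adjoint (R : realType) (H : preHilbertType R)
    (cH : sqnorm_complete H) (b1 b2 : R) (e v : nat -> H)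
    (b1_gt0 : 0 < b1) (b2_gt0 : 0 < b2) (be : bessel_seq b1 e)
    (bv : bessel_seq b2 v) (f h : H) :
  '[transfer e v f, h] = '[f, transfer v e h].
Proof.
have ev := cvg_transfer cH b2_gt0 be bv (f := f).
have ve := cvg_transfer cH b1_gt0 bv be (f := h).
have := cvg_innerr (h := f) ve; have := cvg_innerl (h := h) ev.
suff -> : (fun n => '[transfer_sum e v f n, h]) =
          (fun n => '[f, transfer_sum v e h n]).
  by move=> c1 c2; exact: (@cvg_unique _ (@norm_hausdorff _ R[i]^o) _ _ _ _ c1 c2).
apply/funext => n; rewrite (linear_sumlz inner) (linear_sumr inner).
apply: eq_bigr => k _.
rewrite (linearZl_LR inner) (linearZr_LR inner)/= mulrC.
by rewrite -[Num.conj]/(@conjc R) -innerC.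
Qed.

(** * Gram-Schmidt orthonormalization *)

Section GramSchmidt.
Context (R : realType) (H : preHilbertType R) (u : nat -> H).
Implicit Types x h : H.

(** The zero vector stays zero, so dependent entries yield zero vectors and the indices stay aligned
    with those of [u]. *)
Definition normalize x : H := (Num.sqrt (sqnorm x))^-1%:C%C *: x.

Lemma normalizeK x : (Num.sqrt (sqnorm x))%:C%C *: normalize x = x.
Proof.
rewrite /normalize scalerA -rmorphM/=.
have [->|x0] := eqVneq x 0; first by rewrite !scaler0.
rewrite divff ?rmorph1 ?scale1r// gt_eqF// sqrtr_gt0 lt_neqAle sqnorm_ge0.
by rewrite andbT eq_sym; apply: contra x0 => /eqP/sqnorm_eq0 ->.
Qed.

Lemma sqnorm_normalize x : sqnorm (normalize x) = (x != 0)%:R.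
Proof.
have [->|x0] := eqVneq x 0; first by rewrite /normalize scaler0 sqnorm0.
have sx : sqnorm x != 0 by apply: contra x0 => /eqP/sqnorm_eq0 ->.
rewrite /normalize sqnormZ sqnormE/= expr0n addr0 exprVn sqr_sqrtr ?sqnorm_ge0//.
by rewrite mulVf.
Qed.

(** The recursion carries all earlier vectors, since each step subtracts the projections onto them;
    [gsE] recovers the usual formula. *)
Fixpoint gs_list n : seq H :=
  if n is m.+1 then
    rcons (gs_list m)
      (normalize (u m - \sum_(v <- gs_list m) '[u m, v] *: v))
  else [::].

Definition gs n : H := last 0 (gs_list n.+1).

Definition gs_res n : H := u n - \sum_(0 <= k < n) '[u n, gs k] *: gs k.

Lemma gsE n : gs n = normalize (gs_res n).
Proof.
have gs_listE m : gs_list m = mkseq gs m.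
  elim: m => [//|m IHm]; rewrite mkseqS -IHm /=.
  by rewrite /gs /= last_rcons.
by rewrite /gs /= last_rcons gs_listE big_map /gs_res /index_iota subn0.
Qed.

Lemma inner_gs_res n h : '[gs_res n, h] =
  '[u n, h] - \sum_(0 <= k < n) '[u n, gs k] * '[gs k, h].
Proof.
rewrite (linearBl inner) (linear_sumlz inner); congr (_ - _).
by apply: eq_bigr => k _; rewrite (linearZl_LR inner).
Qed.

Lemma inner_gs n h : '[gs n, h] = (Num.sqrt (sqnorm (gs_res n)))^-1%:C%C *
  ('[u n, h] - \sum_(0 <= k < n) '[u n, gs k] * '[gs k, h]).
Proof. by rewrite -inner_gs_res gsE (linearZl_LR inner). Qed.

Lemma sqnorm_gs n : sqnorm (gs n) = (gs_res n != 0)%:R.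
Proof. by rewrite gsE sqnorm_normalize. Qed.

Lemma gs_inner n : '[gs n, gs n] = (gs_res n != 0)%:R.
Proof. by rewrite sqnorm_inner sqnorm_gs rmorph_nat. Qed.

(** Strong induction on the larger index [k]: only the term at [i] survives in [inner_gs], and it
    cancels ['[u k, gs i]] when [gs i] is a unit vector. Otherwise [gs i] is zero. *)
Lemma gs_orthogonal n m : n != m -> '[gs n, gs m] = 0.
Proof.
suff h k i : (i < k)%N -> '[gs k, gs i] = 0.
  rewrite neq_ltn => /orP[nm|mn]; last exact: h.
  by rewrite innerC h// conjc0.
elim/ltn_ind: k i => k IHk i ik.
rewrite inner_gs.
rewrite (bigD1_seq i) ?mem_index_iota ?iota_uniq//= big1_seq => [|j]; last first.
  rewrite mem_index_iota => /andP[ji /andP[_ jk]].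
  have [ij|ij] := ltnP i j; first by rewrite IHk ?mulr0.
  have {}ij : (j < i)%N by rewrite ltn_neqAle ji.
  by rewrite (innerC (gs j)) (IHk i ik j ij) conjc0 mulr0.
rewrite addr0 gs_inner.
have [r0|_] := eqVneq (gs_res i) 0; last by rewrite mulr1 subrr mulr0.
by rewrite {1}gsE r0 /normalize scaler0 linear0r mulr0 subr0 mulr0.
Qed.

Lemma gs_bessel : bessel_seq 1 gs.
Proof.
move=> m n h; rewrite mul1r; apply: bessel_inequality => [|i j|i].
- exact: iota_uniq.
- exact: gs_orthogonal.
- by rewrite sqnorm_gs lern1 leq_b1.
Qed.

(** Each [u n] is a combination of [gs 0], ..., [gs n], even when its residual vanishes. *)
Lemma gs_total h : (forall n, '[h, gs n] = 0) -> forall n, '[h, u n] = 0.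
Proof.
move=> hgs n; have -> : u n = (Num.sqrt (sqnorm (gs_res n)))%:C%C *: gs n +
    \sum_(0 <= k < n) '[u n, gs k] *: gs k.
  by rewrite gsE normalizeK subrK.
rewrite (linearDr inner) (linearZr_LR inner)/= hgs mulr0 add0r.
rewrite (linear_sumr inner) big1// => k _.
by rewrite (linearZr_LR inner)/= hgs mulr0.
Qed.

Lemma gs_annihilator h n : (forall k, (k < n)%N -> '[u k, h] = 0) ->
  forall k, (k < n)%N -> '[gs k, h] = 0.
Proof.
move=> uh; elim/ltn_ind => k IHk kn.
rewrite inner_gs uh// sub0r.
rewrite big1_seq ?oppr0 ?mulr0// => j.
rewrite mem_index_iota => /andP[_ /andP[_ jk]].
by rewrite IHk ?mulr0// (ltn_trans jk).
Qed.

(** The vector [h] certifies that [u n] is outside the span of its predecessors; it will be a member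
    of the biorthogonal family. *)
Lemma gs_res_neq0 h n : (forall k, (k < n)%N -> '[u k, h] = 0) ->
  '[u n, h] != 0 -> gs_res n != 0.
Proof.
move=> uh; apply: contra_neq => r0.
have : '[gs_res n, h] = 0 by rewrite r0 linear0l.
rewrite inner_gs_res big1_seq ?subr0// => j.
rewrite mem_index_iota => /andP[_ /andP[_ jn]].
by rewrite (gs_annihilator uh) ?mulr0.
Qed.

Lemma gs_eq0 n : u n = 0 -> gs n = 0.
Proof.
move=> un0; rewrite gsE /gs_res un0 big1 ?subr0 ?/normalize ?scaler0// => k _.
by rewrite linear0l scale0r.
Qed.

End GramSchmidt.

(** * Frames with a biorthogonal family *)

Lemma biorthogonal_frame_riesz (R : realType) (H : preHilbertType R)
    (I : countType) (phi g : I -> H) :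
  sqnorm_complete H -> is_frame phi ->
  (forall j k, '[phi j, g k] = (j == k)%:R) -> riesz_basis phi.
Proof.
move=> cH [a [b [a0 b0 phib]]] bio.
(* The family becomes a sequence through [pickle]; numbers that encode no index carry the zero
   vector, which affects neither sums nor Gram-Schmidt. *)
pose u n := oapp phi 0 (pickle_inv n).
pose psi := gs u.
pose chi (k : I) := psi (choice.pickle k).
have upickle k : u (choice.pickle k) = phi k by rewrite /u pickleK_inv.
have psi_out n : pickle_inv n = None :> option I -> psi n = 0.
  by move=> nN; apply: gs_eq0; rewrite /u nN.
have ub : bessel_seq b u.
  move=> m n h.
  have -> : \sum_(m <= k < n) sqnorm '[h, u k] =
      \sum_(k <- pmap pickle_inv (index_iota m n)) sqnorm '[h, phi k].
    rewrite big_pmap; apply: eq_bigr => k _; rewrite /u.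
    by case: pickle_inv => //=; rewrite linear0r sqnorm0.
  rewrite -lee_fin; have /andP[_] := phib h; apply: le_trans.
  set r := pmap _ _.
  have ur : uniq r by rewrite (pmap_uniq (@pickle_invK I))// iota_uniq.
  apply: esum_ge; exists [set` r]; first by split=> //; exact: finite_seq.
  by rewrite -fsbig_seq// sumEFin.
have psib : bessel_seq 1 psi by exact: gs_bessel.
have psi_orth := @gs_orthogonal _ _ u.
(* The residual is nonzero because [g k] annihilates every earlier [u i] but not [phi k]. *)
have chi1 k : '[chi k, chi k] = 1.
  rewrite gs_inner (gs_res_neq0 (h := g k))// => [i ik|].
    rewrite /u; case Ei : pickle_inv => [j|/=]; last by rewrite linear0l.
    rewrite bio (_ : (j == k) = false)//; apply: contraTF ik => /eqP jk.
    by have := @pickle_invK I i; rewrite Ei /= jk => ->; rewrite ltnn.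
  by rewrite upickle bio eqxx oner_eq0.
have chi_orth j k : j != k -> '[chi j, chi k] = 0.
  move=> jk; apply: psi_orth; apply: contra jk => /eqP.
  by move/(pcan_inj (@choice.pickleK I)) => ->.
(* Such an [h] is orthogonal to all [phi k], and the lower frame bound forces it to vanish. *)
have psi_total h : (forall n, '[h, psi n] = 0) -> h = 0.
  move=> /gs_total hu; apply: sqnorm_eq0; apply/eqP.
  rewrite eq_le sqnorm_ge0 andbT -(ler_pM2l a0) mulr0 -lee_fin.
  have /andP[/le_trans + _] := phib h; apply; rewrite esum1// => k _.
  by rewrite -upickle hu sqnorm0.
pose Xi := transfer psi u; pose W := transfer u psi.
have adj f h : '[Xi f, h] = '[f, W h].
  exact: (transfer_adjoint cH ltr01 b0 psib ub).
have Xichi k : Xi (chi k) = phi k.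
  rewrite /Xi (@transfer_single _ _ _ _ _ (choice.pickle k)) => [|i ik].
    by rewrite -[psi _]/(chi k) chi1 scale1r upickle.
  by apply: psi_orth; rewrite eq_sym.
have Wcoef h k : '[W h, chi k] = '[h, phi k].
  by rewrite innerC -adj Xichi -innerC.
(* The frame coefficients of [h] are the [chi]-coefficients of [W h], so Bessel's inequality bounds
   each finite partial sum. *)
have Wge h : a * sqnorm h <= sqnorm (W h).
  rewrite -lee_fin; have /andP[+ _] := phib h; move/le_trans; apply.
  apply: ge_ereal_sup => _ [X [finX _] <-].
  rewrite fsbig_finite//= sumEFin lee_fin.
  under eq_bigr do rewrite -Wcoef.
  apply: bessel_inequality => [||k]; [exact: fset_uniq|exact: chi_orth|].
  by rewrite /sqnorm inner_norm chi1.
have XiE f : sqnorm (Xi f) <= b * 1 * sqnorm f.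
  exact: (sqnorm_transfer cH b0 psib ub).
have psiE n : psi n = oapp chi 0 (pickle_inv n).
  case En : pickle_inv => [k|/=]; last exact: psi_out.
  by have := @pickle_invK I n; rewrite En /= /chi => ->.
have Wg j : W (g j) = chi j.
  have gu i : '[g j, u i] = (choice.pickle j == i)%:R.
    rewrite innerC /u; case Ei : pickle_inv => [k|/=].
      have := @pickle_invK I i; rewrite Ei /= => <-.
      rewrite bio (inj_eq (pcan_inj (@choice.pickleK I))) eq_sym.
      by rewrite -[conjc _]/(Num.conj _) rmorph_nat.
    rewrite linear0l conjc0; case: eqP => // ji.
    by move: Ei; rewrite -ji pickleK_inv.
  rewrite /W (@transfer_single _ _ _ _ _ (choice.pickle j)) => [|i ij].
    by rewrite gu eqxx scale1r.
  by rewrite gu eq_sym (negbTE ij).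
pose XiL : {linear H -> H} := HB.pack Xi
  (GRing.isLinear.Build _ _ _ _ Xi (transfer_is_linear cH b0 psib ub)).
pose WL : {linear H -> H} := HB.pack W
  (GRing.isLinear.Build _ _ _ _ W (transfer_is_linear cH ltr01 ub psib)).
(* Since [chi j = W (g j)], the coefficient ['[f, chi j]] equals ['[Xi f, g j]] and is determined by
   [Xi f]. *)
have Xi_inj : injective Xi.
  move=> f h fh; apply/eqP; rewrite -subr_eq0; apply/eqP/psi_total => n.
  rewrite psiE; case: pickle_inv => [j|/=]; last by rewrite linear0r.
  by rewrite /= -Wg (linearBl inner)/= -(adj f) -(adj h) fh subrr.
have Xi_surj h : exists x, Xi x = h.
  (* For [S = Xi W], ['[S f, f]] is [|W f|^2]: it is at least [a |f|^2] by [Wge], and [|S f|^2] is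
     at most [b |W f|^2]. *)
  have [f|f|x <-] := @coercive_surjective _ _ (XiL \o WL) a b cH a0 b0 _ _ h.
  - by rewrite /= adj sqnorm_inner.
  - by rewrite /= adj sqnorm_inner (le_trans (XiE _))// mulr1.
  - by exists (W x).
exists chi, XiL; split.
- split=> [k j|].
    by have [->|kj] := eqVneq k j; [exact: chi1|exact: chi_orth].
  apply/seteqP; split=> // f _ B fB.
  (* Both sides have the same [psi]-coefficients, so partial sums of the expansion approximate [f]
     from the span of [chi]. *)
  have expand : transfer psi psi f = f.
    apply/eqP; rewrite -subr_eq0; apply/eqP/psi_total => n.
    rewrite (linearBl inner)/= (transfer_adjoint cH ltr01 ltr01 psib psib).
    rewrite (@transfer_single _ _ _ _ _ n) => [|i ni]; last first.
      by apply: psi_orth; rewrite eq_sym.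
    rewrite psiE; case: pickle_inv => [j|/=]; last by rewrite scaler0 subrr.
    by rewrite /= chi1 scale1r subrr.
  have := cvg_transfer cH ltr01 psib psib (f := f).
  rewrite -/(transfer psi psi f) expand => /(_ _ fB) [N _ hN].
  exists (transfer_sum psi psi f N); split; last exact: (hN N (leqnn N)).
  (* Dropping the zero terms turns the partial sum into a combination of the [chi k]. *)
  pose r : seq I := pmap pickle_inv (index_iota 0 N).
  exists (size r), (fun i => '[f, chi (tnth (in_tuple r) i)]),
    (fun i => chi (tnth (in_tuple r) i)).
  split=> [i|]; first by exists (tnth (in_tuple r) i).
  rewrite -(big_tnth _ _ r xpredT (fun k => '[f, chi k] *: chi k)) big_pmap.
  apply: eq_bigr => i _; rewrite psiE.
  by case: pickle_inv => //=; rewrite scaler0.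
- exists (Num.sqrt b) => f.
  rewrite !normC_sqnorm -rmorphM lecR -(sqrtrM _ (ltW b0)).
  by apply: ler_wsqrtr; rewrite (le_trans (XiE f))// mulr1.
- have inv h := cid (Xi_surj h).
  exists (fun h => sval (inv h)) => h.
    by apply: Xi_inj; rewrite (svalP (inv _)).
  exact: (svalP (inv h)).
- by move=> k; rewrite -Xichi.
Qed.

(** * Truncated families *)

Section DualOfFiniteFamily.
Context (R : realType) (H : preHilbertType R) (I : countType) (phi : I -> H).
Hypothesis phi_indep : lin_indep phi.
Variable r : seq I.
Hypothesis r_uniq : uniq r.

Lemma lin_indep_seq (c : I -> R[i]) :
  \sum_(k <- r) c k *: phi k = 0 -> forall k, k \in r -> c k = 0.
Proof.
move=> c0 k kr; have rP : perm_eq [fset j in r]%fset r.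
  by apply: uniq_perm => // j; rewrite !inE.
by apply: (phi_indep (J := [fset j in r]%fset)); rewrite ?(perm_big _ rP)// !inE.
Qed.

(* Linear independence makes the Gram matrix invertible. *)
Lemma dual_vector_exists k : k \in r -> exists c : I -> R[i],
  forall j, j \in r -> '[\sum_(i <- r) c i *: phi i, phi j] = (j == k)%:R.
Proof.
move=> kr; pose m := size r; pose e i := tnth (in_tuple r) i.
have er i : e i \in r by exact: mem_tnth.
(* Reads a row of coefficients as a function on [I], zero outside [r]. *)
pose ext (c : 'rV[R[i]]_m) (j : I) : R[i] :=
  if insub (index j r) is Some i then c 0 i else 0.
have extE c i : ext c (e i) = c 0 i.
  by rewrite /ext /e (tnth_nth k) index_uniq// valK.
have sumE c : \sum_(j <- r) ext c j *: phi j = \sum_i c 0 i *: phi (e i).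
  by rewrite big_tnth; apply: eq_bigr => i _; rewrite -/(e i) extE.
pose G : 'M[R[i]]_m := \matrix_(i, j) '[phi (e i), phi (e j)].
have GE c j : (c *m G) 0 j = '[\sum_(i <- r) ext c i *: phi i, phi (e j)].
  rewrite sumE (linear_sumlz inner) mxE; apply: eq_bigr => i _.
  by rewrite mxE (linearZl_LR inner).
(* A combination killed by [G] is orthogonal to each [phi (e i)], hence to itself, so it is zero and
   independence applies. *)
have Gu : G \in unitmx.
  rewrite -row_free_unit; apply: inj_row_free => c cG0.
  set x := \sum_(i <- r) ext c i *: phi i.
  have xe j : '[x, phi (e j)] = 0 by rewrite -GE cG0 mxE.
  have x0 : x = 0.
    apply: sqnorm_eq0; apply: complexI; rewrite -sqnorm_inner {2}/x sumE.
    rewrite (linear_sumr inner) big1// => i _.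
    by rewrite (linearZr_LR inner)/= xe mulr0.
  by apply/rowP => i; rewrite mxE -extE; exact: lin_indep_seq x0 _ (er i).
have ek : exists i, e i = k.
  have kr' : (index k r < m)%N by rewrite index_mem.
  by exists (Ordinal kr'); rewrite /e (tnth_nth k) nth_index.
have [i0 i0k] := ek.
(* The row of the inverse Gram matrix at the position of [k]. *)
exists (ext (delta_mx 0 i0 *m invmx G)) => j jr.
have kr' : (index j r < m)%N by rewrite index_mem.
have <- : e (Ordinal kr') = j by rewrite /e (tnth_nth k) nth_index.
rewrite -GE mulmxKV// mxE eqxx /= -i0k; congr (_%:R); congr nat_of_bool.
have einj : injective e by apply/tuple_uniqP.
by rewrite (inj_eq einj).
Qed.

End DualOfFiniteFamily.

Lemma sym_range_uniq s : uniq (sym_range s).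
Proof. by rewrite map_inj_uniq ?iota_uniq// => i j /addIr []. Qed.

(** With [p] the inverse image of [phi k], the sum of ['[p, phi i] *: phi i] is [phi k];
    independence allows comparing coefficients. *)
Lemma trunc_biorthogonal (R : realType) (H : preHilbertType R)
    (phi : int * int -> H) s t j k : lin_indep phi ->
  j.1 \in sym_range s -> j.2 \in sym_range t ->
  k.1 \in sym_range s -> k.2 \in sym_range t ->
  '[phi j, pinv (trunc_span phi s t) (trunc_frame_op phi s t) (phi k)]
    = (j == k)%:R.
Proof.
move=> phi_indep js jt ks kt.
pose r := [seq (n, l) | n <- sym_range s, l <- sym_range t].
have ur : uniq r by rewrite allpairs_uniq ?sym_range_uniq// => -[? ?] [? ?].
have rP i : (i \in r) = (i.1 \in sym_range s) && (i.2 \in sym_range t).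
  case: i => n l; apply/allpairsP/andP => [[[? ?] [? ? [-> ->]]]//|[? ?]].
  by exists (n, l).
have SE f : trunc_frame_op phi s t f = \sum_(i <- r) '[f, phi i] *: phi i.
  by rewrite big_allpairs.
have jr : j \in r by rewrite rP js.
have kr : k \in r by rewrite rP ks.
have sumk : \sum_(i <- r) (i == k)%:R *: phi i = phi k.
  rewrite (bigD1_seq k)//= eqxx scale1r big1 ?addr0// => i /negbTE ->.
  by rewrite scale0r.
set p := pinv _ _ _.
have Sp : trunc_frame_op phi s t p = phi k.
  (* [pinv] inverts only on the image of the span; the dual vector of [k] shows that [phi k] lies in
     it. *)
  apply: pinvK; apply: mem_set.
  have [c cE] := dual_vector_exists phi_indep ur kr.
  exists (\sum_(i <- r) c i *: phi i).
    exists (size r), (c \o tnth (in_tuple r)), (phi \o tnth (in_tuple r)).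
    split=> [i|]; last by rewrite big_tnth.
    exists (tnth (in_tuple r) i) => //=.
    by apply/andP; rewrite -rP mem_tnth.
  rewrite SE -sumk big_seq [RHS]big_seq; apply: eq_bigr => i ir.
  by rewrite cE.
have := lin_indep_seq phi_indep ur (c := fun i => '[p, phi i] - (i == k)%:R).
under eq_bigr do rewrite scalerBl.
rewrite sumrB sumk -SE Sp subrr => /(_ erefl j jr)/eqP.
rewrite subr_eq0 => /eqP pj; rewrite innerC pj.
by rewrite -[conjc _]/(Num.conj _) rmorph_nat.
Qed.

(** Once the index box contains both [j] and [k] the truncated pairing is constant, and limits are
    unique. *)
Lemma trunc_limit_biorthogonal (R : realType) (H : preHilbertType R)
    (phi g : int * int -> H) : lin_indep phi ->
  (forall f k,
    ('[f, pinv (trunc_span phi st.1 st.2) (trunc_frame_op phi st.1 st.2)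
            (phi k)] : R[i]^o) @[st --> (\oo, \oo)] --> ('[f, g k] : R[i]^o)) ->
  forall j k, '[phi j, g k] = (j == k)%:R.
Proof.
move=> phi_indep phig j k; have := phig (phi j) k.
have c : ('[phi j, pinv (trunc_span phi st.1 st.2)
    (trunc_frame_op phi st.1 st.2) (phi k)] : R[i]^o)
    @[st --> (\oo, \oo)] --> ((j == k)%:R : R[i]^o).
  apply: cvg_near_cst.
  exists ([set s | (maxn `|j.1| `|k.1| <= s)%N],
          [set t | (maxn `|j.2| `|k.2| <= t)%N]).
    by split; [exists (maxn `|j.1| `|k.1|)|exists (maxn `|j.2| `|k.2|)].
  move=> [s t] /= [+ +]; rewrite !geq_max => /andP[js ks] /andP[jt kt].
  by apply: trunc_biorthogonal => //; rewrite mem_sym_range -abszE lez_nat.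
by move/(@cvg_unique _ (@norm_hausdorff _ R[i]^o) _ _ _ _)/(_ c).
Qed.

(** * Completeness of L2 *)

Section L2Completeness.
Context (R : realType).
Local Notation mu := (@lebesgue_measure R).
Local Open Scope quotient_scope.

(* AM-GM: [|d_k| <= 2 ^ k d_k ^ 2 + 2 ^ - k]. *)
Lemma cvgn_weighted_increments (w : nat -> R) :
  (\sum_(0 <= k <oo) (2 ^+ k * (w k.+1 - w k) ^+ 2)%:E < +oo)%E -> cvgn w.
Proof.
move=> wfin; have -> : w = fun n => w 0%N + series (telescope w) n.
  by apply/funext => n; exact: eq_sum_telescope.
apply: is_cvgD; first exact: is_cvg_cst.
apply: normed_cvg.
pose v k := 2 ^+ k * (w k.+1 - w k) ^+ 2.
have v0 k : 0 <= v k by rewrite mulr_ge0 ?sqr_ge0 ?exprn_ge0.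
have cv : cvgn (series v) by exact: nnseries_is_cvg.
apply: (@series_le_cvg _ _ (v + geometric 1 2^-1)) => [k|k|k|].
- exact: normr_ge0.
- by rewrite addr_ge0// /geometric/= mul1r exprn_ge0 ?invr_ge0.
- rewrite /= -[(v + _) k]/(v k + 1 * 2^-1 ^+ k) /v /telescope.
  set d := w k.+1 - w k; rewrite -real_normK ?num_real//.
  set t := 2 ^+ k; rewrite mul1r exprVn -/t.
  have t0 : 0 < t by rewrite exprn_gt0.
  have -> : t * `|d| ^+ 2 + t^-1 = `|d| + t^-1 * ((t * `|d| - 1) ^+ 2 + t * `|d|).
    by field; rewrite gt_eqF.
  by rewrite lerDl mulr_ge0 ?invr_ge0 ?(ltW t0)// addr_ge0 ?sqr_ge0// mulr_ge0// ltW.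
- apply: is_cvg_seriesD => //; apply: is_cvg_geometric_series.
  by rewrite ger0_norm ?invr_ge0// invf_lt1// ltr1n.
Qed.

Lemma measurable_sqnorm (f : R -> R[i]) :
  measurable_fun [set: R] (Re \o f) -> measurable_fun [set: R] (Im \o f) ->
  measurable_fun [set: R] (fun x => (sqnorm (f x))%:E).
Proof.
move=> mR mI; apply/measurable_EFinP; under eq_fun do rewrite sqnormE.
by apply: measurable_funD; exact: measurable_funX.
Qed.

Lemma sqnorm_L2 (f : L2fun R) :
  (sqnorm (\pi_(L2 R) f))%:E = (\int[mu]_x (sqnorm (f x))%:E)%E.
Proof.
have [mR mI fin] := L2funP f.
have -> : sqnorm (\pi_(L2 R) f) = Rintegral mu setT (fun x => sqnorm (f x)).
  by apply: complexI; rewrite -sqnorm_inner -L2fdotE -L2dot_pi.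
rewrite fineK// ge0_fin_numE// integral_ge0// => x _.
by rewrite lee_fin sqnorm_ge0.
Qed.

Lemma sqnorm_L2B (f g : L2fun R) :
  (sqnorm (\pi_(L2 R) f - \pi_(L2 R) g))%:E
  = (\int[mu]_x (sqnorm (f x - g x))%:E)%E.
Proof.
have -> : \pi_(L2 R) f - \pi_(L2 R) g = \pi_(L2 R) (f - g) by rewrite !piE.
exact: sqnorm_L2.
Qed.

(** Riesz-Fischer: a fast subsequence converges almost everywhere, and Fatou's lemma makes its
    pointwise limit the norm limit of the whole sequence. *)
Lemma sqnorm_complete_L2 : sqnorm_complete (L2 R).
Proof.
move=> u uC.
have [N NP] : exists N : nat -> nat, forall k m n, (N k <= m <= n)%N ->
    sqnorm (u n - u m) <= 4^-1 ^+ k.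
  have {}uC k : exists N, forall m n, (N <= m <= n)%N ->
      sqnorm (u n - u m) <= 4^-1 ^+ k.
    by apply: uC; rewrite exprn_gt0.
  have [N NP] := choice uC; by exists N.
(* Cumulative sums make the indices monotone and above [N]; the successor gives [k <= M k]. *)
pose M k := (\sum_(0 <= i < k.+1) (N i).+1)%N.
have MN k : (N k <= M k)%N by rewrite /M big_nat_recr//= addnS ltnW// ltnS leq_addl.
have MS k : (M k <= M k.+1)%N by rewrite /M [in leqRHS]big_nat_recr//= leq_addr.
have Mge k : (k <= M k)%N.
  elim: k => [//|k IHk]; rewrite /M big_nat_recr//= addnS ltnS.
  exact: leq_trans IHk (leq_addr _ _).
pose F k : L2fun R := repr (u (M k)).
have piF k : \pi_(L2 R) (F k) = u (M k) by rewrite reprK.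
have mRF k : measurable_fun setT (Re \o F k) by have [] := L2funP (F k).
have mIF k : measurable_fun setT (Im \o F k) by have [] := L2funP (F k).
(* The rate [4^-1 ^+ k] beats the weight [2 ^+ k], so the integral of [D k] is at most
   [2^-1 ^+ k]. *)
pose D k x := ((2 ^+ k * sqnorm (F k.+1 x - F k x))%:E : \bar R).
have D0 k x : (0 <= D k x)%E.
  by rewrite lee_fin mulr_ge0 ?exprn_ge0 ?sqnorm_ge0.
have msub k : measurable_fun setT (fun x => (sqnorm (F k.+1 x - F k x))%:E).
  by have [mR mI _] := L2funP (F k.+1 - F k); exact: measurable_sqnorm mR mI.
have mD k : measurable_fun setT (D k).
  apply/measurable_EFinP/measurable_funM => //.
  by apply/measurable_EFinP; exact: msub.
pose G x := (\sum_(0 <= k <oo) D k x)%E.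
have mG : measurable_fun setT G.
  by apply: (@ge0_emeasurable_sum _ _ _ _ D xpredT).
have intG : (\int[mu]_x G x < +oo)%E.
  rewrite integral_nneseries//.
  have half := cvg_lim (@ereal_hausdorff R) (@cvg_geometric_eseries_half R 2 0).
  apply: (@le_lt_trans _ _ (2 / 2 ^+ 0)%:E); last exact: ltry.
  rewrite -half; apply: lee_nneseries => [k _ _|k _].
    by apply: integral_ge0 => x _; exact: D0.
  rewrite /D; under eq_integral do rewrite EFinM.
  have s0 x : setT x -> (0 <= (sqnorm (F k.+1 x - F k x))%:E)%E.
    by rewrite lee_fin sqnorm_ge0.
  rewrite (ge0_integralZl_EFin mu measurableT s0 (msub k)) ?exprn_ge0//.
  rewrite -sqnorm_L2B !piF -EFinM lee_fin.
  have := NP k (M k) (M k.+1); rewrite MN MS => /(_ erefl) uk.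
  apply: (le_trans (ler_wpM2l _ uk)); first by rewrite exprn_ge0.
  rewrite addn1 natrX exprS invfM mulrA divff// mul1r -exprVn -exprMn.
  by rewrite (_ : 2 * 4^-1 = 2^-1)//; field.
have G0 x : (0 <= G x)%E by exact: nneseries_ge0.
have finG : {ae mu, forall x, (G x < +oo)%E}.
  have /integrable_ae : mu.-integrable setT G.
    apply/integrableP; split=> //.
    by under eq_integral do rewrite gee0_abs//.
  move=> /(_ measurableT).
  apply: (@filterS _ _ (ae_filter_ringOfSetsType mu)) => x /(_ Logic.I).
  by rewrite ge0_fin_numE.
pose E : set R := [set x | (G x < +oo)%E].
have mE : measurable E.
  by rewrite -[E]setTI; exact: emeasurable_fun_infty_o.
(* Cutting off to [E] makes the sequences converge everywhere, so that their limits are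
   measurable. *)
pose fR k x : R := \1_E x * Re (F k x).
pose fI k x : R := \1_E x * Im (F k x).
have increments_cvg (part : R[i] -> R) x : E x ->
    (forall y z, (part y - part z) ^+ 2 <= sqnorm (y - z)) ->
    cvgn (fun k => part (F k x)).
  move=> Ex part_le; apply: cvgn_weighted_increments; apply: le_lt_trans Ex.
  apply: lee_nneseries => [k _ _|k _].
    by rewrite lee_fin mulr_ge0 ?sqr_ge0 ?exprn_ge0.
  by rewrite lee_fin ler_pM2l ?exprn_gt0.
have cfR x : cvgn (fR ^~ x).
  rewrite /fR indicE; have [/set_mem Ex|_] := boolP (x \in E); last first.
    by under eq_fun do rewrite mul0r; exact: is_cvg_cst.
  under eq_fun do rewrite mul1r; apply: increments_cvg => // -[y1 y2] [z1 z2].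
  by rewrite sqnormE /= lerDl sqr_ge0.
have cfI x : cvgn (fI ^~ x).
  rewrite /fI indicE; have [/set_mem Ex|_] := boolP (x \in E); last first.
    by under eq_fun do rewrite mul0r; exact: is_cvg_cst.
  under eq_fun do rewrite mul1r; apply: increments_cvg => // -[y1 y2] [z1 z2].
  by rewrite sqnormE /= lerDr sqr_ge0.
pose f x : R[i] := (limn (fR ^~ x) +i* limn (fI ^~ x))%C.
have m1 : measurable_fun setT (\1_E : R -> R) by exact: measurable_indic.
have mfR k : measurable_fun setT (fR k).
  by apply: (measurable_funM m1); exact: mRF.
have mfI k : measurable_fun setT (fI k).
  by apply: (measurable_funM m1); exact: mIF.
have mRf : measurable_fun setT (Re \o f).
  by apply: (@measurable_fun_cvg _ _ _ _ fR) => // x _; exact: cfR.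
have mIf : measurable_fun setT (Im \o f).
  by apply: (@measurable_fun_cvg _ _ _ _ fI) => // x _; exact: cfI.
(* Used twice: with [g] a fixed term to place [f] in L2, and with [g] a representative of [u n] for
   convergence. *)
have fatou_bound (g : L2fun R) (e : R) :
    (\forall k \near \oo, sqnorm (u (M k) - \pi_(L2 R) g) <= e) ->
    (\int[mu]_x (sqnorm (f x - g x))%:E <= e%:E)%E.
  move=> ue; have [mRg mIg _] := L2funP g.
  pose h k x : \bar R := (sqnorm ((fR k x +i* fI k x)%C - g x))%:E.
  have mh k : measurable_fun setT (h k).
    apply: measurable_sqnorm.
      rewrite (_ : _ \o _ = fR k \- (Re \o g)); first exact: measurable_funB.
      by apply/funext => x /=; case: (g x).
    rewrite (_ : _ \o _ = fI k \- (Im \o g)); first exact: measurable_funB.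
    by apply/funext => x /=; case: (g x).
  have h0 k x : setT x -> (0 <= h k x)%E by rewrite lee_fin sqnorm_ge0.
  have hE x : limn_einf (h ^~ x) = (sqnorm (f x - g x))%:E.
    have hc : h ^~ x @ \oo --> (sqnorm (f x - g x))%:E.
      apply: cvg_EFin; first exact: nearW.
      have fg y1 y2 : sqnorm ((y1 +i* y2)%C - g x) =
          (y1 - Re (g x)) ^+ 2 + (y2 - Im (g x)) ^+ 2.
        by rewrite sqnormE; case: (g x).
      rewrite /f fg (_ : fine \o _ = fun k =>
          (fR k x - Re (g x)) ^+ 2 + (fI k x - Im (g x)) ^+ 2); last first.
        by apply/funext => k /=; rewrite fg.
      have sq_cvg (v : nat -> R) c : cvgn v ->
          (fun k => (v k - c) ^+ 2) @ \oo --> (limn v - c) ^+ 2.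
        by move=> cv; apply: cvgM; apply: cvgB => //; exact: cvg_cst.
      by apply: cvgD; exact: sq_cvg.
    rewrite is_cvg_limn_einfE; first exact: cvg_lim hc.
    by apply/cvg_ex; eexists; exact: hc.
  (* The cutoff alters the integrand only on the null set where [G] is infinite. *)
  have inth k : (\int[mu]_x h k x = (sqnorm (u (M k) - \pi_(L2 R) g))%:E)%E.
    rewrite -piF sqnorm_L2B; apply: ae_eq_integral => //.
    - exact: mh.
    - by have [mR mI _] := L2funP (F k - g); exact: measurable_sqnorm mR mI.
    apply: (@filterS _ _ (ae_filter_ringOfSetsType mu) _ _ _ finG) => x Ex _.
    rewrite /h /fR /fI indicE mem_set// !mul1r.
    by case: (F k x).
  under eq_integral do rewrite -hE.
  apply: (le_trans (fatou mu measurableT mh h0)); rewrite limn_einf_lim.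
  apply: lime_le; first exact: is_cvg_einfs.
  move: ue; apply: filterS => k uk; apply: (@le_trans _ _ (\int[mu]_x h k x)%E).
    by apply: ereal_inf_lbound; exists k => //=.
  by rewrite inth lee_fin.
(* Write [f] as [(f - g) + g]; the bound 1 below is [4^-1 ^+ 0]. *)
have fL2 : f \in @L2fun_pred R.
  pose g : L2fun R := repr (u (N 0%N)).
  have [mRg mIg _] := L2funP g.
  rewrite -(subrK (g : R -> R[i]) f) rpredD//; last by case: (g).
  have subE (y z : R[i]) : Re (y - z) = Re y - Re z /\ Im (y - z) = Im y - Im z.
    by case: y z => ? ? [].
  apply/asboolP; split.
  - rewrite (_ : _ \o _ = (Re \o f) \- (Re \o g)); first exact: measurable_funB.
    by apply/funext => x; exact: (subE (f x) (g x)).1.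
  - rewrite (_ : _ \o _ = (Im \o f) \- (Im \o g)); first exact: measurable_funB.
    by apply/funext => x; exact: (subE (f x) (g x)).2.
  apply: (@le_lt_trans _ _ 1%:E); last exact: ltry.
  apply: fatou_bound; exists (N 0%N) => // k /= Nk; rewrite reprK.
  by rewrite -(expr0 4^-1) NP// leqnn (leq_trans Nk).
pose l : L2 R := \pi_(L2 R) (MkL2fun fL2).
apply/cvg_ex; exists l; apply/cvg_sqnormP => e /uC[N0 N0P].
exists N0 => // n /= N0n.
rewrite -sqnormN opprB -[u n]reprK -lee_fin sqnorm_L2B.
apply: fatou_bound; exists n => // k /= nk; rewrite reprK.
by apply: N0P; rewrite N0n (leq_trans nk).
Qed.

End L2Completeness.

Theorem theorem6p3 (R : realType) (q : int -> R) (phi : int -> L2 R)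
    (q_gt0 : forall l, 0 < q l)
    (phi_frame : is_frame (translates q phi))
    (phi_indep : lin_indep (translates q phi))
    (phi_cvg : forall (f : L2 R) (n l : int),
      ('[f, pinv (trunc_span (translates q phi) st.1 st.2)
                 (trunc_frame_op (translates q phi) st.1 st.2)
                 (translates q phi (n, l))] : R[i]^o)
        @[st --> (\oo, \oo)] -->
      ('[f, pinv [set: L2 R] (frame_op (translates q phi))
                 (translates q phi (n, l))] : R[i]^o)) :
  riesz_basis (translates q phi).
Proof.
pose g k := pinv [set: L2 R] (frame_op (translates q phi)) (translates q phi k).
apply: (biorthogonal_frame_riesz (g := g) (@sqnorm_complete_L2 R) phi_frame).
by apply: (trunc_limit_biorthogonal phi_indep) => f [n l]; exact: phi_cvg.
Qed.
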